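(* Let $Y$ be a real vector space. A binary relation $\prec\,\subset Y\times Y$ is a compatible weak preference on $Y$ if and only if there exists a step-linear function $u:Y\to\mathbb{R}$ such that for all $y,z\in Y$ $$y\prec z\iff u(z-y)>0$$ and $$y\sim z\iff u(z-y)=0,$$ where $\sim$ is the equipotency relation generated by $\prec$.
   Context: A partial preference on $Y$ is an asymmetric and transitive binary relation $\prec$. The indifference relation generated by $\prec$ is: $y\asymp z$ iff neither $y\prec z$ nor $z\prec y$. The equipotency relation generated by $\prec$ is: $y_1\sim y_2$ iff $\{y\in Y\mid y\asymp y_1\}=\{y\in Y\mid y\asymp y_2\}$. A partial preference is a weak preference if $\asymp$ is transitive. A binary relation $\prec$ is compatible if $y_1\prec y_2$ implies $\lambda y_1\prec\lambda y_2$ and $y_1+y\prec y_2+y$ for all $y\in Y$ and all real $\lambda>0$. Let $\mathcal{L}(Y,\mathbb{R})$ be the vector space of linear functions on $Y$. A family $\mathcal{F}\subset\mathcal{L}(Y,\mathbb{R})$ forms a cortege of linear functions on $Y$ if: (i) $\mathcal{F}$ is ordered by some linear order $\unlhd_{\mathcal{F}}$; (ii) for each $y\in Y$ either the subfamily $\mathcal{F}_y:=\{\phi\in\mathcal{F}\mid\phi(y)\ne0\}$ is empty or $\mathcal{F}_y$ has a least element $\phi_y$ with respect to $\unlhd_{\mathcal{F}}$; (iii) for each $\phi\in\mathcal{F}$ there exists $y\in Y$ such that $\phi=\phi_y$. A function $u:Y\to\mathbb{R}$ is step-linear if there is a cortege of linear functions $\mathcal{F}$ such that $u=u_{\mathcal{F}}$,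 where $u_{\mathcal{F}}(y)=0$ if $\mathcal{F}_y=\varnothing$ and $u_{\mathcal{F}}(y)=\phi_y(y)$ if $\mathcal{F}_y\neq\varnothing$. *)

(* Defs.v *)
From HB Require Import structures.
From mathcomp Require Import all_boot all_order all_algebra.
From mathcomp Require Import boolp classical_sets reals.

Set Implicit Arguments.
Unset Strict Implicit.
Unset Printing Implicit Defensive.
Import Order.TTheory GRing.Theory Num.Theory.
Local Open Scope classical_set_scope.
Local Open Scope ring_scope.

Section Preferences.
Variables (R : realType) (Y : lmodType R).
Implicit Types prec : Y -> Y -> Prop.

Definition partial_preference prec : Prop :=
  (forall y z, prec y z -> ~ prec z y) /\
  (forall x y z, prec x y -> prec y z -> prec x z).

Definition indifferent prec (y z : Y) : Prop := ~ prec y z /\ ~ prec z y.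

Definition equipotent prec (y1 y2 : Y) : Prop :=
  [set y | indifferent prec y y1] = [set y | indifferent prec y y2].

Definition weak_preference prec : Prop :=
  partial_preference prec /\
  (forall x y z,
    indifferent prec x y -> indifferent prec y z -> indifferent prec x z).

Definition compatible prec : Prop :=
  forall y1 y2, prec y1 y2 ->
    (forall lambda : R, 0 < lambda -> prec (lambda *: y1) (lambda *: y2)) /\
    (forall y, prec (y1 + y) (y2 + y)).

End Preferences.

Section Corteges.
Variables (R : realType) (Y : lmodType R).
Implicit Types (F : set {scalar Y}) (le : {scalar Y} -> {scalar Y} -> Prop).

Definition linear_order_on F le : Prop :=
  [/\ forall f, F f -> le f f,
      forall f g, F f -> F g -> le f g -> le g f -> f = g,
      forall f g h, F f -> F g -> F h -> le f g -> le g h -> le f h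
    & total_on F le].

Definition nonvanishing F (y : Y) : set {scalar Y} :=
  [set phi | F phi /\ phi y != 0].

Definition is_least le F (phi : {scalar Y}) : Prop :=
  F phi /\ forall psi, F psi -> le phi psi.

Definition cortege F le : Prop :=
  [/\ linear_order_on F le,
      forall y, nonvanishing F y = set0 \/
        exists phi, is_least le (nonvanishing F y) phi
    & forall phi, F phi -> exists y, is_least le (nonvanishing F y) phi].

(* The least element [phi_y] of [F_y]; the zero form is a junk value, used only
   when there is no least element. *)
Definition leading_form F le (y : Y) : {scalar Y} :=
  if pselect (exists phi, is_least le (nonvanishing F y) phi) is left ex_phi
  then sval (cid ex_phi) else \0.

Definition cortege_fun F le (y : Y) : R :=
  if pselect (nonvanishing F y = set0) then 0 else leading_form F le y y.

Definition step_linear (u : Y -> R) : Prop :=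
  exists F le, cortege F le /\ u = cortege_fun F le.

End Corteges.

(* Main.v *)
(** Let [P] be the cone of vectors preferred to 0.  A vector [y] is infinitesimal
with respect to [e] in [P] when [e + t y] lies in [P] for every real [t]; these
vectors form a subspace [W_e], and the [W_e] are totally ordered by inclusion.
They play the role of the Archimedean classes of the totally ordered space of
indifference classes.  If [e] is not infinitesimal with respect to [y] in [P],
a supremum argument gives [t] with [y - t e] in [W_e].  For each subspace [W]
among the [W_e], pick a representative [e] and a linear form on the whole
of [Y] that is 1 at [e] and vanishes on [W].  These forms, ordered by reverse
inclusion of the subspaces, are a cortege, and the leading form of [y] has at
[y] the sign of [y]. *)
Require Import Defs.
From HB Require Import structures.
From mathcomp Require Import all_boot all_order all_algebra.
From mathcomp Require Import boolp classical_sets reals.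
From mathcomp Require Import lra.
Import Order.TTheory GRing.Theory Num.Theory.
Local Open Scope ring_scope.

(** * Linear forms vanishing on a subspace *)

Section SeparatingForm.
Set Implicit Arguments.
Unset Strict Implicit.
Variables (R : realType) (Y : lmodType R).
Local Open Scope classical_set_scope.

Definition subspace (W : set Y) : Prop :=
  [/\ W 0, forall x y, W x -> W y -> W (x + y)
    & forall (t : R) x, W x -> W (t *: x)].

Lemma subspaceB (W : set Y) x y : subspace W -> W x -> W y -> W (x - y).
Proof. by move=> [_ WD WZ] Wx Wy; apply: WD => //; rewrite -scaleN1r; apply: WZ. Qed.

Lemma maximal_subspace_avoiding (W : set Y) e : subspace W -> ~ W e ->
  exists M, [/\ subspace M, W `<=` M, ~ M e
    & forall N, subspace N -> M `<=` N -> ~ N e -> N `<=` M].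
Proof.
move=> subW We.
(* The union with [W] makes the empty chain harmless in Zorn's lemma. *)
pose Q (A : set Y) := subspace (W `|` A) /\ ~ (W `|` A) e.
have [C CQ Ctot|A [[subA Ae] Amax]] := @Zorn_bigcup Y Q.
  have [W0 WD WZ] := subW.
  split; last first.
    case=> [//|[A CA Ae]]; have [_] := CQ _ CA; apply; by right.
  (* Since the members of [C] form a chain, two vectors of the union lie together in [W] or in a
     single [W] joined with [A], so closure is inherited. *)
  have pair x y : (W `|` \bigcup_(A in C) A) x -> (W `|` \bigcup_(A in C) A) y ->
      (W x /\ W y) \/ exists2 A, C A & (W `|` A) x /\ (W `|` A) y.
    case=> [Wx|[A CA Ax]] [Wy|[B CB By]].
    - by left.
    - by right; exists B => //; split; [left|right].
    - by right; exists A => //; split; [right|left].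
    - have [AB|BA] := Ctot _ _ CA CB; right.
        by exists B => //; split; right => //; apply: AB.
      by exists A => //; split; right => //; apply: BA.
  have up A x : C A -> (W `|` A) x -> (W `|` \bigcup_(A in C) A) x.
    by move=> CA [Wx|Ax]; [left|right; exists A].
  split; first by left.
    move=> x y hx hy; have [[Wx Wy]|[A CA [Ax Ay]]] := pair _ _ hx hy.
      by left; apply: WD.
    by apply: (up A) => //; have [[_ AD _] _] := CQ _ CA; apply: AD.
  move=> t x hx; have [[Wx _]|[A CA [Ax _]]] := pair _ _ hx hx.
    by left; apply: WZ.
  by apply: (up A) => //; have [[_ _ AZ] _] := CQ _ CA; apply: AZ.
exists (W `|` A); split => //.
move=> N subN AN Ne x Nx; apply: contrapT => nAx.
have WNN : W `|` N = N.
  by apply/seteqP; split => [z [Wz|//]|z Nz]; [apply: AN; left|right].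
apply: (Amax N); last by split; rewrite WNN.
split; first by move=> z Az; apply: AN; right.
by move=> NA; apply: nAx; right; apply: NA.
Qed.

(** A maximal subspace [M] containing [W] and avoiding [e] is a hyperplane: each [y] is congruent
    modulo [M] to exactly one multiple of [e]. The coefficient of that multiple, as a function of
    [y], is the form. *)
Lemma scalar_separation (W : set Y) e : subspace W -> ~ W e ->
  exists f : {scalar Y}, f e = 1 /\ forall w, W w -> f w = 0.
Proof.
move=> subW We.
have [M [subM WM Me Mmax]] := maximal_subspace_avoiding subW We.
have [M0 MD MZ] := subM.
have dec y : exists t : R, M (y - t *: e).
  apply: contrapT => ny.
  pose N := [set z | exists t : R, M (z - t *: y)].
  have subN : subspace N.
    split; first by exists 0; rewrite scale0r subr0.
      move=> a b [s Ms] [t Mt]; exists (s + t).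
      by rewrite scalerDl opprD addrACA; apply: MD.
    by move=> s a [t Mt]; exists (s * t); rewrite -scalerA -scalerBr; apply: MZ.
  (* [N] is the span of [M] and [y]. If it avoided [e], maximality would put [y] in [M], and the
     coefficient 0 would serve for [y]. *)
  have [t Mt] : N e.
    apply: contrapT => Ne; apply: ny; exists 0; rewrite scale0r subr0.
    apply: (Mmax N) => //; last by exists 1; rewrite scale1r subrr.
    by move=> z Mz; exists 0; rewrite scale0r subr0.
  have t0 : t != 0.
    by apply/eqP => t0; apply: Me; move: Mt; rewrite t0 scale0r subr0.
  apply: ny; exists t^-1; rewrite -opprB -scaleN1r; apply: (MZ).
  have -> : t^-1 *: e - y = t^-1 *: (e - t *: y).
    by rewrite scalerBr scalerA mulVf // scale1r.
  exact: MZ.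
have uniq y s t : M (y - s *: e) -> M (y - t *: e) -> s = t.
  move=> Ms Mt; apply: contrapT => /eqP st; apply: Me.
  have := subspaceB subM Mt Ms.
  rewrite opprB addrC addrA addrNK -scalerBl => /(MZ (s - t)^-1).
  by rewrite scalerA mulVf ?subr_eq0 // scale1r.
have [f fP] := choice dec.
have f_lin : linear_for *%R f.
  move=> a x y; apply: (uniq (a *: x + y)) => //.
  rewrite scalerDl -scalerA opprD addrACA -scalerBr.
  by apply: MD => //; apply: MZ.
pose F : {scalar Y} := HB.pack f (GRing.isLinear.Build R Y R *%R f f_lin).
exists F; split=> [|w Ww].
  by apply: (uniq e) => //; rewrite scale1r subrr.
by apply: (uniq w) => //; rewrite scale0r subr0; apply: WM.
Qed.

End SeparatingForm.

(** * Step-linear functions induce compatible weak preferences *)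

Section CortegeFun.
Set Implicit Arguments.
Unset Strict Implicit.
Variables (R : realType) (Y : lmodType R).
Variables (F : set {scalar Y}) (le : {scalar Y} -> {scalar Y} -> Prop).
Hypothesis cF : cortege F le.

Lemma cortege_fun_least y phi :
  is_least le (nonvanishing F y) phi -> cortege_fun F le y = phi y.
Proof.
move=> hphi; rewrite /cortege_fun /leading_form; case: (pselect (_ = set0)) => [F0|nF0] /=.
  by have [] := hphi; rewrite F0.
case: (pselect (exists _, _)) => [ex|[]]; last by exists phi.
case: (cid ex) => psi hpsi /=.
have [[_ anti _ _] _ _] := cF.
have [[[Fphi phi0] lphi] [[Fpsi psi0] lpsi]] := (hphi, hpsi).
suff -> : psi = phi by [].
by apply: anti => //; [apply: lpsi|apply: lphi].
Qed.

Lemma cortege_fun_vanishing y :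
  nonvanishing F y = set0 -> cortege_fun F le y = 0.
Proof. by move=> F0; rewrite /cortege_fun; case: (pselect (_ = set0)). Qed.

(** The zero set is thus an intersection of kernels, hence a subspace; this is what makes
    indifference transitive. *)
Lemma cortege_fun_eq0 y :
  cortege_fun F le y = 0 <-> forall phi, F phi -> phi y = 0.
Proof.
split=> [u0 phi Fphi|F0]; last first.
  apply: cortege_fun_vanishing; apply/seteqP; split => // phi [/F0 ->].
  by rewrite eqxx.
have [_ /(_ y) + _] := cF; case=> [/seteqP[+ _]|[psi hpsi]].
  by move=> h; apply: contrapT => /eqP phi0; apply: (h phi).
by have [[_]] := hpsi; rewrite -(cortege_fun_least hpsi) u0 eqxx.
Qed.

Lemma cortege_fun_gt0 y : 0 < cortege_fun F le y <->
  exists2 phi, is_least le (nonvanishing F y) phi & 0 < phi y.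
Proof.
split=> [u0|[phi hphi]]; last by rewrite (cortege_fun_least hphi).
have [_ /(_ y) + _] := cF; case=> [F0|[phi hphi]].
  by move: u0; rewrite cortege_fun_vanishing // ltxx.
by exists phi => //; rewrite -(cortege_fun_least hphi).
Qed.

Lemma nonvanishingZ (t : R) y :
  t != 0 -> nonvanishing F (t *: y) = nonvanishing F y.
Proof.
by move=> t0; apply/seteqP; split=> phi [Fphi];
  rewrite /nonvanishing /= linearZ /= mulf_eq0 negb_or t0.
Qed.

Lemma cortege_funZ (t : R) y : cortege_fun F le (t *: y) = t * cortege_fun F le y.
Proof.
have [->|t0] := eqVneq t 0.
  rewrite scale0r mul0r; apply/cortege_fun_eq0 => phi _; exact: linear0.
have [_ /(_ y) + _] := cF; case=> [F0|[phi hphi]].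
  by rewrite !cortege_fun_vanishing ?mulr0 ?nonvanishingZ.
rewrite (cortege_fun_least hphi) (@cortege_fun_least _ phi) ?linearZ //.
by rewrite nonvanishingZ.
Qed.

Lemma cortege_funN y : cortege_fun F le (- y) = - cortege_fun F le y.
Proof. by rewrite -scaleN1r cortege_funZ mulN1r. Qed.

(** The smaller of the two leading forms leads the sum as well: every form before it vanishes at
    both vectors. *)
Lemma cortege_fun_gt0D x y : 0 < cortege_fun F le x -> 0 < cortege_fun F le y ->
  0 < cortege_fun F le (x + y).
Proof.
have [[_ anti trans tot] _ _] := cF.
move=> /cortege_fun_gt0[f hf fx] /cortege_fun_gt0[g hg gy].
wlog fg : x y f g hf fx hg gy / le f g.
  move=> wl; have [[[Ff _] _] [[Fg _] _]] := (hf, hg).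
  have [fg|gf] := tot f g Ff Fg; first exact: (wl x y f g).
  by rewrite addrC; apply: (wl y x g f).
apply/cortege_fun_gt0; have [[[Ff _] lf] [[Fg gy0] lg]] := (hf, hg).
(* [g] is least among the forms not vanishing at [y], so [f], being at most [g], either vanishes at
   [y] or equals [g]. *)
have fy : 0 <= f y.
  have [->//|fy0] := eqVneq (f y) 0.
  suff -> : f = g by exact: ltW.
  by apply: anti => //; apply: lg.
have fxy : 0 < f (x + y) by rewrite linearD ltr_wpDr.
exists f => //; split; first by split => //; rewrite gt_eqF.
move=> psi [Fpsi]; rewrite linearD /= => psi0.
have [px|px] := eqVneq (psi x) 0; last exact: lf.
apply: (trans f g psi) => //; apply: lg; split => //.
by move: psi0; rewrite px add0r.
Qed.

Lemma cortege_fun_preference (prec : Y -> Y -> Prop) :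
  (forall y z, prec y z <-> 0 < cortege_fun F le (z - y)) ->
  weak_preference prec /\ compatible prec.
Proof.
move=> precE.
have indE x y : indifferent prec x y <-> cortege_fun F le (y - x) = 0.
  rewrite /indifferent !precE -(opprB y x) cortege_funN oppr_gt0.
  split=> [[/negP + /negP]|->]; last by rewrite ltxx.
  by rewrite -!leNgt => h1 h2; apply/eqP; rewrite eq_le h1.
split; first split; first split.
- move=> y z; rewrite !precE -(opprB z y) cortege_funN oppr_gt0 => h1 h2.
  by have := lt_trans h1 h2; rewrite ltxx.
- move=> x y z; rewrite !precE => xy yz.
  by rewrite -(subrKA y); apply: cortege_fun_gt0D.
- move=> x y z; rewrite !indE => /cortege_fun_eq0 xy /cortege_fun_eq0 yz.
  apply/cortege_fun_eq0 => phi Fphi.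
  by rewrite -(subrKA y) linearD /= xy // yz // addr0.
move=> y z /precE yz; split=> [t t0|x]; rewrite precE.
  by rewrite -scalerBr cortege_funZ mulr_gt0.
by rewrite opprD addrACA subrr addr0.
Qed.

End CortegeFun.

(** * From a cone to a cortege *)

Section Cone.
Set Implicit Arguments.
Unset Strict Implicit.
Variables (R : realType) (Y : lmodType R) (P : Y -> Prop).
Local Open Scope classical_set_scope.

(** With [P] the vectors preferred to 0, these are the vectors indifferent to 0. *)
Definition neutral x := ~ P x /\ ~ P (- x).

Hypothesis PD : forall x y, P x -> P y -> P (x + y).
Hypothesis PZ : forall (t : R) x, 0 < t -> P x -> P (t *: x).
Hypothesis PN : forall x, P x -> ~ P (- x).
Hypothesis neutralD : forall x y, neutral x -> neutral y -> neutral (x + y).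

Definition infinitesimal (e : Y) : set Y := [set y | forall t : R, P (e + t *: y)].

Lemma cone0 : ~ P 0.
Proof. by move=> P0; apply: (PN P0); rewrite oppr0. Qed.

Lemma cone_cases x : [\/ P x, P (- x) | neutral x].
Proof.
have [Px|nPx] := pselect (P x); first by constructor 1.
have [Px'|nPx'] := pselect (P (- x)); first by constructor 2.
by constructor 3.
Qed.

Lemma neutralN x : neutral x -> neutral (- x).
Proof. by move=> [h1 h2]; split; rewrite ?opprK. Qed.

(** If [x] is neutral, then [x + y] cannot be neutral, or the difference [y] would be; nor can its
    opposite lie in [P], since adding [y] would give [- x] in [P]. *)
Lemma cone_addl x y : ~ P (- x) -> P y -> P (x + y).
Proof.
move=> nx Py; have [Px|//|neux] := cone_cases x; first exact: PD.
have [//|Pxy|neuxy] := cone_cases (x + y).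
  by have := PD Pxy Py; rewrite opprD addrNK.
have [nPy _] := neutralD neuxy (neutralN neux).
by case: nPy; rewrite addrC addKr.
Qed.

Lemma cone_scale_inv (t : R) x : 0 < t -> P (t *: x) -> P x.
Proof.
move=> t0; have ti : 0 < t^-1 by rewrite invr_gt0.
by move=> /(PZ ti); rewrite scalerA mulVf ?gt_eqF // scale1r.
Qed.

Lemma cone_scale_gt0 (t : R) e : P e -> P (t *: e) -> 0 < t.
Proof.
move=> Pe Pte; rewrite ltNge; apply/negP => t0.
have [tE|tn0] := eqVneq t 0; first by move: Pte; rewrite tE scale0r; exact: cone0.
have tn : 0 < - t by rewrite oppr_gt0 lt_neqAle tn0.
by have := PN (PZ tn Pe); rewrite scaleNr opprK.
Qed.

Lemma neutralZ (t : R) x : neutral x -> neutral (t *: x).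
Proof.
move=> neux; have pos s : 0 < s -> neutral (s *: x).
  move=> s0; have [nPx nPNx] := neux.
  by split; rewrite -?scalerN => /(cone_scale_inv s0).
have [t0|t0|->] := ltgtP t 0; last by rewrite scale0r; split; rewrite ?oppr0; exact: cone0.
  by rewrite -[t]opprK scaleNr; apply: neutralN; apply: pos; rewrite oppr_gt0.
exact: pos.
Qed.

Lemma infinitesimal_subspace e : P e -> subspace (infinitesimal e).
Proof.
move=> Pe; split; first by move=> t; rewrite scaler0 addr0.
  move=> x y Wx Wy t; apply: (@cone_scale_inv 2) => //.
  (* Doubling supplies one copy of [e] for each of [x] and [y]. *)
  have -> : 2%:R *: (e + t *: (x + y)) =
            (e + (2%:R * t) *: x) + (e + (2%:R * t) *: y).
    by rewrite addrACA -scalerDr (scalerDr 2%:R) scalerA scaler_nat mulr2n.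
  exact: PD.
by move=> s x Wx t; rewrite scalerA.
Qed.

Lemma not_infinitesimal_refl e : ~ infinitesimal e e.
Proof. by move=> /(_ (-1)); rewrite scaleN1r subrr; exact: cone0. Qed.

Lemma neutral_infinitesimal e y : P e -> neutral y -> infinitesimal e y.
Proof.
move=> Pe ney t; rewrite addrC; apply: cone_addl => //.
by have [] := neutralZ t ney.
Qed.

(** The coefficient is the supremum of the [r] with [y - r *: e] in [P]; the two bounds make this
    set nonempty and bounded above. After division by the absolute value of [q], a negative [q]
    calls for a number above the supremum, a positive [q] for a member of the set close to it. *)
Lemma infinitesimal_remainder_sup e y (s : R) :
  P e -> P (s *: e - y) -> P (y + s *: e) ->
  exists t : R, infinitesimal e (y - t *: e).
Proof.
move=> Pe ub lb.
pose S := [set r : R | P (y - r *: e)].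
have supS : has_sup S.
  split; first by exists (- s); rewrite /S /= scaleNr opprK.
  exists s => r Sr; have := PD ub Sr; rewrite addrA addrNK -scalerBl.
  by move=> /(cone_scale_gt0 Pe); rewrite subr_gt0 => /ltW.
exists (sup S) => q; set t := sup S.
have [q0|q0|->] := ltgtP q 0; last by rewrite scale0r addr0.
- have p0 : 0 < - q^-1 by rewrite oppr_gt0 invr_lt0.
  apply: (cone_scale_inv p0); rewrite scalerDr scalerA mulNr mulVf ?lt_eqF //.
  rewrite scaleN1r opprB addrA -scalerDl addrC.
  (* Half of the room above [t] takes [t + d] out of [S], which only says that [y - (t + d) *: e] is
     not in [P]; the other half, [d *: e], restores strict membership through [cone_addl]. *)
  pose d := - q^-1 / 2%:R; have d0 : 0 < d by rewrite divr_gt0.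
  have -> : (- q^-1 + t) *: e = (t + d) *: e + d *: e.
    by rewrite -scalerDl; congr (_ *: _); rewrite /d; lra.
  rewrite addrA; apply: cone_addl; last exact: PZ.
  rewrite opprD opprK => St; have := sup_upper_bound supS St.
  by rewrite -/t; lra.
- have p0 : 0 < q^-1 by rewrite invr_gt0.
  apply: (cone_scale_inv p0); rewrite scalerDr scalerA mulVf ?gt_eqF // scale1r.
  have [r Sr tr] := sup_adherent p0 supS; rewrite -/t in tr.
  have -> : q^-1 *: e + (y - t *: e) = (y - r *: e) + (r - t + q^-1) *: e.
    rewrite addrCA -addrA; congr (_ + _).
    by rewrite -scaleNr -scaleNr -!scalerDl; congr (_ *: _); lra.
  by apply: PD => //; apply: PZ => //; lra.
Qed.

Lemma infinitesimal_remainder e y : P e -> P y -> ~ infinitesimal y e ->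
  exists t : R, infinitesimal e (y - t *: e).
Proof.
move=> Pe Py /existsNP[t nP].
(* As [y + t *: e] is not in [P], adding to its opposite a positive multiple of [e] lands in [P];
   the bound exceeds [- t] for this, and is positive for the other premise. *)
apply: (@infinitesimal_remainder_sup e y (`|t| + 1)) => //; last first.
  by apply: PD => //; apply: PZ => //; rewrite ltr_wpDl.
have -> : (`|t| + 1) *: e - y = - (y + t *: e) + (`|t| + t + 1) *: e.
  by rewrite opprD -scaleNr -addrA -scalerDl [RHS]addrC; congr (_ *: _ - _); lra.
apply: cone_addl; first by rewrite opprK.
by apply: PZ => //; have := ler_norm (- t); rewrite normrN; lra.
Qed.

Lemma infinitesimal_coef_gt0 e y (t : R) : P e -> P y -> ~ infinitesimal e y ->
  infinitesimal e (y - t *: e) -> 0 < t.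
Proof.
move=> Pe Py nW W; rewrite ltNge; apply/negP => t_le0.
have [tE|t0] := eqVneq t 0; first by move: W; rewrite tE scale0r subr0.
have {t_le0}t_lt0 : t < 0 by rewrite lt_neqAle t0.
(* At the parameter [t^-1] the vector [e] cancels and [t^-1 *: y] is left in [P], although [t^-1] is
   negative. *)
have := W t^-1; rewrite scalerBr scalerA mulVf // scale1r addrC addrNK.
have := PZ (_ : 0 < - t^-1) Py; rewrite oppr_gt0 invr_lt0 => /(_ t_lt0).
by rewrite scaleNr => P1 P2; apply: (PN P2).
Qed.

(** This comparison makes the subspaces a chain. Either [b - a] is in [P] and can be added to
    [a + t *: y], or [b] is a positive multiple of [a] up to an element of [infinitesimal a]. *)
Lemma infinitesimal_sub a b : P a -> P b -> ~ infinitesimal a b ->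
  infinitesimal a `<=` infinitesimal b.
Proof.
move=> Pa Pb nW y Wy.
have [Wab|nWab] := pselect (infinitesimal b a).
  move=> t; have := PD (Wab (-1)) (Wy t).
  by rewrite scaleN1r addrA addrNK.
have [t Wt] := infinitesimal_remainder Pa Pb nWab.
have t0 := infinitesimal_coef_gt0 Pa Pb nW Wt.
have [_ WD WZ] := infinitesimal_subspace Pa.
(* Here [b + s *: y] is [t] times [a + t^-1 *: ((b - t *: a) + s *: y)]. *)
move=> s; have := WZ t^-1 _ (WD _ _ Wt (WZ s _ Wy)) => /(_ 1).
rewrite scale1r => /(PZ t0); rewrite scalerDr scalerA mulfV ?gt_eqF // scale1r.
by rewrite addrA subrKC.
Qed.

Lemma infinitesimal_eqP a b : P a -> P b ->
  infinitesimal a = infinitesimal b <->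
  ~ infinitesimal a b /\ ~ infinitesimal b a.
Proof.
move=> Pa Pb; split=> [E|[ab ba]].
  by split; [rewrite E|rewrite -E]; exact: not_infinitesimal_refl.
by apply/seteqP; split; apply: infinitesimal_sub.
Qed.

Lemma cone_step_linear : exists2 u : Y -> R, step_linear u &
  forall y, (P y <-> 0 < u y) /\ (neutral y <-> u y = 0).
Proof.
(* Choosing by subspace rather than by vector gives vectors with the same infinitesimals the same
   form, which antisymmetry of the order requires. The zero form is a default for the other sets. *)
have /choice[phi phiP] : forall W : set Y, exists f : {scalar Y},
    (exists2 e, P e & infinitesimal e = W) ->
    exists e, [/\ P e, infinitesimal e = W, f e = 1 & forall w, W w -> f w = 0].
  move=> W.
  have [[e Pe eW]|nW] := pselect (exists2 e, P e & infinitesimal e = W); last first.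
    by exists \0.
  have [f [fe fW]] :=
    scalar_separation (infinitesimal_subspace Pe) (@not_infinitesimal_refl e).
  by exists f => _; exists e; split => // w; rewrite -eW; exact: fW.
pose form e := phi (infinitesimal e).
have formW d y : P d -> infinitesimal d y -> form d y = 0.
  by move=> Pd Wy; have [|e [_ _ _]] := phiP (infinitesimal d); [exists d|exact].
(* With [e] the representative, [y] is [t *: e] plus an infinitesimal, so the value is [t]. *)
have form_gt0 y : P y -> 0 < form y y.
  move=> Py; have [|e [Pe eW fe fW]] := phiP (infinitesimal y); first by exists y.
  have [nWe nWy] := (infinitesimal_eqP Pe Py).1 eW.
  have [t Wt] := infinitesimal_remainder Pe Py nWy.
  have t0 := infinitesimal_coef_gt0 Pe Py nWe Wt.
  rewrite eW in Wt; have := fW _ Wt.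
  by rewrite linearB /= linearZ /= fe mulr1 -/(form y) => /subr0_eq ->.
pose F := [set f | exists2 e, P e & f = form e].
(* The order is on forms, hence the quantified generators; [form_inj] makes their choice
   immaterial. *)
pose le (f g : {scalar Y}) := exists a b,
  [/\ P a, P b, f = form a, g = form b & infinitesimal b `<=` infinitesimal a].
have form_inj a b : P a -> P b -> form a = form b ->
    infinitesimal a = infinitesimal b.
  move=> Pa Pb ab; apply/infinitesimal_eqP => //; split=> W.
    by have := form_gt0 b Pb; rewrite -ab formW // ltxx.
  by have := form_gt0 a Pa; rewrite ab formW // ltxx.
have Fform e : P e -> F (form e) by exists e.
have le_form a b : P a -> P b ->
    le (form a) (form b) <-> infinitesimal b `<=` infinitesimal a.
  move=> Pa Pb; split=> [[a' [b' [Pa' Pb' aa bb]]]|ba]; last by exists a, b.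
  by rewrite (form_inj _ _ Pa Pa' aa) (form_inj _ _ Pb Pb' bb).
(* A form not vanishing at [y] comes from some [d] with [y] outside [infinitesimal d], so
   [infinitesimal_sub] puts [form y] before it. *)
have least y : P y -> is_least le (nonvanishing F y) (form y).
  move=> Py; split; first by split; [exact: Fform|rewrite gt_eqF ?form_gt0].
  move=> _ [[d Pd ->] dy]; apply/le_form => //.
  by apply: infinitesimal_sub => // Wdy; rewrite formW // eqxx in dy.
have nvN y : nonvanishing F (- y) = nonvanishing F y.
  by apply/seteqP; split=> f [Ff]; rewrite /nonvanishing /= linearN oppr_eq0.
have nv0 y : neutral y -> nonvanishing F y = set0.
  move=> ney; apply/seteqP; split=> // _ [[d Pd ->]].
  by rewrite formW ?eqxx //; exact: neutral_infinitesimal.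
have cF : cortege F le.
  split.
  - split.
    + by move=> _ [a Pa ->]; apply/le_form.
    + move=> _ _ [a Pa ->] [b Pb ->] /le_form-/(_ Pa Pb) ba /le_form-/(_ Pb Pa) ab.
      by congr phi; apply/seteqP.
    + move=> _ _ _ [a Pa ->] [b Pb ->] [c Pc ->].
      move=> /le_form-/(_ Pa Pb) ba /le_form-/(_ Pb Pc) cb.
      by apply/le_form => //; exact: subset_trans ba.
    + move=> _ _ [a Pa ->] [b Pb ->].
      (* Two vectors are never infinitesimal to each other: [a - b] and [b - a] would both lie in
         [P]. *)
      have [W|nW] := pselect (infinitesimal a b).
        left; apply/le_form => //; apply: infinitesimal_sub => // W'.
        have := PD (W (-1)) (W' (-1)); rewrite !scaleN1r addrA addrNK subrr.
        exact: cone0.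
      by right; apply/le_form => //; exact: infinitesimal_sub.
  - move=> y; have [Py|Py|ney] := cone_cases y; last by left; exact: nv0.
      by right; exists (form y); exact: least.
    by right; exists (form (- y)); rewrite -nvN; exact: least.
  - by move=> _ [e Pe ->]; exists e; exact: least.
exists (cortege_fun F le); first by exists F, le.
have u_gt0 y : P y -> 0 < cortege_fun F le y.
  by move=> Py; rewrite (cortege_fun_least cF (least _ Py)); exact: form_gt0.
have u_lt0 y : P (- y) -> cortege_fun F le y < 0.
  by move=> /u_gt0; rewrite (cortege_funN cF) oppr_gt0.
have u_eq0 y : neutral y -> cortege_fun F le y = 0.
  by move=> /nv0; exact: cortege_fun_vanishing.
move=> y; have [Py|Py|ney] := cone_cases y.
- have u0 := u_gt0 y Py; split; split => //; first by case.
  by move=> uE; rewrite uE ltxx in u0.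
- have u0 := u_lt0 y Py; split; split.
  + by move=> /PN.
  + by move=> /(lt_trans u0); rewrite ltxx.
  + by case.
  + by move=> uE; rewrite uE ltxx in u0.
- rewrite (u_eq0 y ney) ltxx; split; split => //.
  by case: ney.
Qed.

End Cone.

(** * Passage between preferences and cones *)

Theorem theorem5p5 (R : realType) (Y : lmodType R) (prec : Y -> Y -> Prop) :
  (weak_preference prec /\ compatible prec) <->
  exists u : Y -> R, step_linear u /\
    forall y z : Y,
      (prec y z <-> 0 < u (z - y)) /\ (equipotent prec y z <-> u (z - y) = 0).
Proof.
split=> [[[[asym trans] itrans] comp]|[_ [[F [le [cF ->]]] uP]]]; last first.
  by apply: (cortege_fun_preference cF) => y z; have [] := uP y z.
have precD x y z : prec y z -> prec (y + x) (z + x).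
  by move=> /comp[_]; exact.
have precE y z : prec y z <-> prec 0 (z - y).
  split=> [/(precD (- y))|/(precD y)]; first by rewrite subrr.
  by rewrite add0r subrK.
have indE y z : indifferent prec y z <-> neutral (prec 0) (z - y).
  by rewrite /indifferent /neutral opprB (precE y z) (precE z y).
have [x y Px Py|t x t0 /comp[+ _]|x Px|x y nx ny|u su uP] :=
    @cone_step_linear R Y (prec 0).
- by apply: (trans _ y) => //; have := precD y _ _ Px; rewrite add0r.
- by move=> /(_ t t0); rewrite scaler0.
- by move=> /(precD x); rewrite add0r addNr; exact: asym.
(* Transitivity of indifference is applied along 0, [x], [x + y]. *)
- have h1 : indifferent prec 0 x by apply/indE; rewrite subr0.
  have h2 : indifferent prec x (x + y) by apply/indE; rewrite addrC addKr.
  by have := itrans _ _ _ h1 h2; rewrite indE subr0.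
exists u; split => // y z; have [uP1 uP2] := uP (z - y).
split; first by rewrite precE.
rewrite -uP2 -indE.
have isym a b : indifferent prec a b -> indifferent prec b a by case.
(* For a weak preference equipotency is indifference: [y] belongs to its own class by asymmetry, and
   transitivity identifies the classes of indifferent vectors. *)
split=> [E|yz].
  have : [set x | indifferent prec x y]%classic y by split=> /[dup] /asym.
  by rewrite E.
apply/seteqP; split=> x xy; first exact: itrans yz.
by apply: itrans xy _; exact: isym.
Qed.
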